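(* Nontrivial integer solutions $(a,p,q,r,s)$ of the Diophantine system $$\begin{cases}(p^2+q^2)^2-a^2=(r^2+s^2)^2,\\ (p^2-q^2)^2-a^2=(r^2-s^2)^2\end{cases}$$ are given by the formulas $$\begin{aligned}p^2&=k\cdot (x+N)(z+N),\\ q^2&=k\cdot (x-N)(z-N),\\ a&=k\cdot 4N\sqrt{xz},\\ r^2&=k\cdot (x+N)(z-N),\\ s^2&=k\cdot (x-N)(z+N),\end{aligned}$$ where $k$ is an integer and $x$ and $z$ are nontrivial different rational solutions of an arbitrary congruent number equation $C_N$. (The integer $k$ and the solutions $x,z$ must be chosen so that $p,q,a,r,s$ are integers.)
   Context: For a squarefree positive integer $N$, the congruent number equation is $C_N:\ y^2=x^3-N^2x$. A rational solution $(x,y)$ of $C_N$ is nontrivial if $y\neq 0$; its first coordinate is also called a nontrivial rational solution of $C_N$. Thus $x$ and $z$ are the first coordinates of nontrivial rational solutions of the same equation $C_N$. An integer solution $(a,p,q,r,s)$ of the system is called nontrivial if $apqrs\neq 0$, $p\neq q$ and $r\neq s$. It corresponds to two Pythagorean triangles with common leg $a$, other legs $r^2\pm s^2$ and hypotenuses $p^2\pm q^2$ respectively.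
   Formalization: Every nontrivial solution is obtained only up to scaling (m²a, mp, mq, mr, ms), i.e. with k rational, the sign of a and swapping p, q, and assuming r ≠ −s; k ≠ 0 is required. Literally false otherwise: (19680,147,31,93,49) forces k = 576/5. *)

(* Defs.v *)
From HB Require Import structures.
From mathcomp Require Import all_boot all_order all_algebra.

Set Implicit Arguments.
Unset Strict Implicit.
Unset Printing Implicit Defensive.

Import Order.TTheory GRing.Theory Num.Theory.
Local Open Scope ring_scope.

(* No clause 0 < N is needed: N = 0 is excluded by d = 2. *)
Definition squarefree (N : nat) : Prop :=
  forall d : nat, (d ^ 2 %| N)%N -> d = 1%N.

Definition congruent_curve (N : nat) (x y : rat) : Prop :=
  y ^+ 2 = x ^+ 3 - N%:R ^+ 2 * x.

Definition nontrivial_rational_solution (N : nat) (x : rat) : Prop :=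
  exists2 y : rat, congruent_curve N x y & y != 0.

Definition pythagorean_system (a p q r s : int) : Prop :=
  (p ^+ 2 + q ^+ 2) ^+ 2 - a ^+ 2 = (r ^+ 2 + s ^+ 2) ^+ 2 /\
  (p ^+ 2 - q ^+ 2) ^+ 2 - a ^+ 2 = (r ^+ 2 - s ^+ 2) ^+ 2.

Definition nontrivial_solution (a p q r s : int) : Prop :=
  [/\ pythagorean_system a p q r s, a * p * q * r * s != 0, p != q & r != s].

(* The identity for a is stated in a real closed field R because x z is not
   assumed to be a rational square.  Num.sqrt is the nonnegative root. *)
Definition parametric_formulas (R : rcfType) (N : nat) (k : int) (x z : rat)
    (a p q r s : int) : Prop :=
  [/\ (p%:~R : rat) ^+ 2 = k%:~R * ((x + N%:R) * (z + N%:R)),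
      (q%:~R : rat) ^+ 2 = k%:~R * ((x - N%:R) * (z - N%:R)),
      (a%:~R : R) = k%:~R * (4 * N%:R * Num.sqrt (ratr (x * z))),
      (r%:~R : rat) ^+ 2 = k%:~R * ((x + N%:R) * (z - N%:R)) &
      (s%:~R : rat) ^+ 2 = k%:~R * ((x - N%:R) * (z + N%:R))].

Definition given_by_formulas (R : rcfType) (a p q r s : int) : Prop :=
  exists (N : nat) (k : int) (x z : rat),
    [/\ squarefree N, k != 0, x != z,
        nontrivial_rational_solution N x /\ nontrivial_rational_solution N z &
        parametric_formulas R N k x z a p q r s].

(* Main.v *)
Require Import Defs.
From HB Require Import structures.
From mathcomp Require Import all_boot all_order all_algebra.
From mathcomp Require Import ring.

Set Implicit Arguments.
Unset Strict Implicit.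
Unset Printing Implicit Defensive.

Import Order.TTheory GRing.Theory Num.Theory.
Local Open Scope ring_scope.

(** Write P, Q, A, B for the squares of p, q, r, s.  The two equations of the
    system are equivalent to P Q = A B and a^2 = P^2 + Q^2 - A^2 - B^2, and
    together they give (P^2 - B^2) (P^2 - A^2) = (P a)^2 ([system_products]).

    From the formulas to the system.  Since p^2 s^2, p^2 r^2 and k^2 are
    positive, x^2 and z^2 exceed N^2; as x (x^2 - N^2) is a square, this forces
    x, z > N.  Hence x z > 0, so that a^2 = 16 k^2 N^2 x z, and the system
    becomes a pair of polynomial identities in x, z, k, N.  It is nontrivial
    because P - Q = 2 k N (x + z) and A - B = 2 k N (z - x) do not vanish.

    From the system to the formulas.  The ratios P : B = (x + N) : (x - N) and
    P : A = (z + N) : (z - N), which the formulas impose, have the solutions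
    x = N (P + B) / (P - B) and z = N (P + A) / (P - A).  Up to a square factor,
    x^3 - N^2 x is then N (P^2 - B^2), so x lies on C_N when N is the squarefree
    part of p^4 - s^4 = P^2 - B^2; this is [congruent_point_of_quartic].  The
    product (P^2 - B^2) (P^2 - A^2) being a square, P^2 - A^2 has the same
    squarefree part, so z lies on the same curve.  The factor that the formulas
    then ask for is (P - A) (P - B) / (4 N^2 P), and scaling the legs by 2 N |p|
    turns it into the integer k = (P - A) (P - B).

    For N to be positive, P must exceed A and B.  The differences P - A and
    P - B have the same sign because the product above is positive, and if they
    are negative then P Q = A B makes Q exceed A and B; exchanging p and q
    preserves the system ([leg_dichotomy], [pythagorean_system_swap]). *)

(** * Squarefree parts and points of congruent number curves *)

(** Zero is divisible by the square of 2. *)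
Lemma squarefree_gt0 (N : nat) : squarefree N -> (0 < N)%N.
Proof. by case: N => // /(_ 2 (dvdn0 _)). Qed.

Lemma squarefree_part (n : nat) :
  (0 < n)%N ->
  exists2 N : nat, squarefree N & exists t : nat, n = (N * t ^ 2)%N.
Proof.
elim/ltn_ind: n => n IHn n_gt0.
have [/existsP[d /andP[d_gt1 /dvdnP[n' def_n]]] | /existsPn no_d] :=
  boolP [exists d : 'I_n.+1, (1 < d)%N && (d ^ 2 %| n)%N].
  have n'_gt0 : (0 < n')%N by move: n_gt0; rewrite def_n muln_gt0 => /andP[].
  have n'_lt : (n' < n)%N.
    by rewrite def_n ltn_Pmulr // -[1%N](exp1n 2) ltn_exp2r.
  have [N sqfN [t def_n']] := IHn n' n'_lt n'_gt0.
  by exists N => //; exists (t * d)%N; rewrite expnMn mulnA -def_n'.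
exists n; last by exists 1%N; rewrite muln1.
move=> d d2_n.
have d_gt0 : (0 < d)%N.
  by case: d d2_n => //; rewrite dvd0n => /eqP n0; rewrite n0 in n_gt0.
have d_le : (d < n.+1)%N.
  by rewrite ltnS (leq_trans _ (dvdn_leq n_gt0 d2_n)) // leq_pmulr.
have := no_d (Ordinal d_le); rewrite /= d2_n andbT -leqNgt.
by case: d d_gt0 {d2_n d_le} => [|[]].
Qed.

(** With X = (u^2 + v^2) / (u^2 - v^2) one has
    X^3 - X = 4 u^2 v^2 (u^4 - v^4) / (u^2 - v^2)^4, and u^4 - v^4 is N up to a
    square, which the factor N^3 coming from x = N X completes to a square. *)
Lemma congruent_point_of_quartic (N : nat) (u v w : rat) :
    (0 < N)%N -> u != 0 -> v != 0 -> w != 0 -> v ^+ 2 != u ^+ 2 ->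
    u ^+ 4 - v ^+ 4 = N%:R * w ^+ 2 ->
  nontrivial_rational_solution N
    (N%:R * ((u ^+ 2 + v ^+ 2) / (u ^+ 2 - v ^+ 2))).
Proof.
move=> N_gt0 u0 v0 w0 uv quartic.
have N0 : N%:R != 0 :> rat by rewrite pnatr_eq0 -lt0n.
have uv0 : u ^+ 2 - v ^+ 2 != 0 by rewrite subr_eq0 eq_sym.
exists (2 * N%:R ^+ 2 * u * v * w / (u ^+ 2 - v ^+ 2) ^+ 2); last first.
  by rewrite !mulf_neq0 ?invr_eq0 ?expf_neq0.
rewrite /congruent_curve.
transitivity (4 * N%:R ^+ 3 * u ^+ 2 * v ^+ 2 * (N%:R * w ^+ 2)
                / (u ^+ 2 - v ^+ 2) ^+ 4); first by field.
by rewrite -quartic; field.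
Qed.

(** Such a point is on the unbounded component of the real curve: x has the
    sign of x^2 - N^2 because x (x^2 - N^2) is a nonzero square. *)
Lemma congruent_abscissa_gt (N : nat) (x : rat) :
    (0 < N)%N -> nontrivial_rational_solution N x -> 0 < x ^+ 2 - N%:R ^+ 2 ->
  N%:R < x.
Proof.
move=> N_gt0 [y]; rewrite /congruent_curve => eq_y y0 x2.
have : 0 < x * (x ^+ 2 - N%:R ^+ 2).
  suff -> : x * (x ^+ 2 - N%:R ^+ 2) = y ^+ 2 by rewrite exprn_even_gt0.
  by rewrite eq_y; ring.
rewrite pmulr_lgt0 // => x_gt0.
by rewrite -(ltr_pXn2r (n := 2)) ?nnegrE ?ler0n ?ltW // -subr_gt0.
Qed.

Lemma congruent_abscissa_neq (N : nat) (x : rat) :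
  nontrivial_rational_solution N x -> (x + N%:R != 0) && (x - N%:R != 0).
Proof.
case=> y; rewrite /congruent_curve => eq_y /(expf_neq0 2); rewrite eq_y.
suff -> : x ^+ 3 - N%:R ^+ 2 * x = x * ((x + N%:R) * (x - N%:R)).
  by rewrite !mulf_eq0 !negb_or => /andP[].
by ring.
Qed.

(** * From the formulas to the system *)

(** The positivity of x z carries the proof: the square root of a negative
    number being 0 here, the formula for a would otherwise give a = 0. *)
Lemma formulas_nontrivial (R : rcfType) (a p q r s : int) :
  given_by_formulas R a p q r s -> nontrivial_solution a p q r s.
Proof.
move=> [N [k [x [z [sqfN k0 xz [solx solz] [eqp eqq eqa eqr eqs]]]]]].
have N_gt0 := squarefree_gt0 sqfN.
have [xpN xmN] := andP (congruent_abscissa_neq solx).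
have [zpN zmN] := andP (congruent_abscissa_neq solz).
have kQ0 : k%:~R != 0 :> rat by rewrite intr_eq0.
have neq0_of_sqr (n : int) (f : rat) : n%:~R ^+ 2 = f -> f != 0 -> n != 0.
  by move=> <-; rewrite expf_eq0 /= intr_eq0.
have p0 : p != 0 by apply: (neq0_of_sqr _ _ eqp); rewrite !mulf_neq0.
have q0 : q != 0 by apply: (neq0_of_sqr _ _ eqq); rewrite !mulf_neq0.
have r0 : r != 0 by apply: (neq0_of_sqr _ _ eqr); rewrite !mulf_neq0.
have s0 : s != 0 by apply: (neq0_of_sqr _ _ eqs); rewrite !mulf_neq0.
have sqr_gt0 (u w : rat) (m n : int) : m != 0 -> n != 0 -> w != 0 ->
    m%:~R ^+ 2 * n%:~R ^+ 2 = w ^+ 2 * u -> 0 < u.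
  move=> m0 n0 w0 eq_u; have w2 : 0 < w ^+ 2 by rewrite exprn_even_gt0.
  rewrite -(pmulr_rgt0 _ w2) -eq_u -exprMn exprn_even_gt0 //=.
  by rewrite mulf_neq0 ?intr_eq0.
(* (p s)^2 = (k (z + N))^2 (x^2 - N^2), and similarly for z with (p r)^2. *)
have x_gt : N%:R < x.
  apply: congruent_abscissa_gt => //.
  apply: (sqr_gt0 _ (k%:~R * (z + N%:R)) p s) => //; first exact: mulf_neq0.
  by rewrite eqp eqs; ring.
have z_gt : N%:R < z.
  apply: congruent_abscissa_gt => //.
  apply: (sqr_gt0 _ (k%:~R * (x + N%:R)) p r) => //; first exact: mulf_neq0.
  by rewrite eqp eqr; ring.
have NQ : 0 < N%:R :> rat by rewrite ltr0n.
have xz_gt0 : 0 < x * z by rewrite mulr_gt0 ?(lt_trans NQ).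
have eqa2 : a%:~R ^+ 2 = (k%:~R * (4 * N%:R)) ^+ 2 * (x * z) :> rat.
  apply: (fmorph_inj (ratr : {rmorphism rat -> R})).
  rewrite rmorphXn /= ratr_int eqa !exprMn sqr_sqrtr; last first.
    by rewrite ler0q ltW.
  by rewrite -!exprMn !(rmorphXn, rmorphM) /= ratr_int !rmorph_nat; ring.
have a0 : a != 0.
  apply: (neq0_of_sqr _ _ eqa2).
  rewrite mulf_neq0 ?(lt0r_neq0 xz_gt0) // expf_neq0 //.
  by rewrite !mulf_neq0 // lt0r_neq0.
have intQ_inj (m n : int) : m%:~R = n%:~R :> rat -> m = n by exact: intr_inj.
split.
- split; apply: intQ_inj.
    by rewrite !(rmorphB, rmorphD, rmorphXn) /= eqa2 eqp eqq eqr eqs; ring.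
  by rewrite !(rmorphB, rmorphD, rmorphXn) /= eqa2 eqp eqq eqr eqs; ring.
- by rewrite !mulf_neq0.
- apply/eqP => pq; suff : k%:~R * (2 * N%:R * (x + z)) = 0 :> rat.
    apply/eqP; rewrite !mulf_neq0 // lt0r_neq0 //.
    by rewrite addr_gt0 // (lt_trans NQ).
  transitivity (p%:~R ^+ 2 - q%:~R ^+ 2 : rat); last by rewrite pq subrr.
  by rewrite eqp eqq; ring.
- apply/eqP => rs; suff : k%:~R * (2 * N%:R * (z - x)) = 0 :> rat.
    apply/eqP; rewrite !mulf_neq0 // ?(lt0r_neq0 NQ) //.
    by rewrite subr_eq0 eq_sym.
  transitivity (r%:~R ^+ 2 - s%:~R ^+ 2 : rat); last by rewrite rs subrr.
  by rewrite eqr eqs; ring.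
Qed.

(** * From the system to the formulas *)

(** The first identity is a quarter of the difference of the two equations.
    The second comes from their sum, once (r s)^2 is replaced by (p q)^2 in the
    expanded left-hand side. *)
Lemma system_products (a p q r s : int) : pythagorean_system a p q r s ->
  p ^+ 2 * q ^+ 2 = r ^+ 2 * s ^+ 2 /\
  (p ^+ 4 - s ^+ 4) * (p ^+ 4 - r ^+ 4) = (p ^+ 2 * a) ^+ 2.
Proof.
move=> [sum_eq diff_eq].
have prod_eq : p ^+ 2 * q ^+ 2 = r ^+ 2 * s ^+ 2.
  apply: (mulfI (isT : (4 : int) != 0)).
  transitivity (((p ^+ 2 + q ^+ 2) ^+ 2 - a ^+ 2)
                - ((p ^+ 2 - q ^+ 2) ^+ 2 - a ^+ 2)); first by ring.
  by rewrite sum_eq diff_eq; ring.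
split=> //; apply: (mulfI (isT : (2 : int) != 0)).
transitivity (p ^+ 4 * (2 * p ^+ 4 - ((r ^+ 2 + s ^+ 2) ^+ 2
                                      + (r ^+ 2 - s ^+ 2) ^+ 2))
              + 2 * (r ^+ 2 * s ^+ 2) ^+ 2); first by ring.
by rewrite -prod_eq -sum_eq -diff_eq; ring.
Qed.

(** Under the size conditions r^2, s^2 < p^2 the curve parameter, the
    coordinates x, z and the sign of k come out positive, so that the square
    root in the formula for a is the expected positive rational. *)
Lemma formulas_of_dominant (R : rcfType) (a p q r s : int) :
    pythagorean_system a p q r s -> 0 < a -> r != 0 -> s != 0 ->
    r ^+ 2 != s ^+ 2 -> r ^+ 2 < p ^+ 2 -> s ^+ 2 < p ^+ 2 ->
  exists2 m : int, 0 < m &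
    given_by_formulas R (m ^+ 2 * a) (m * p) (m * q) (m * r) (m * s).
Proof.
move=> sys a_gt0 r0 s0 rs r_lt_p s_lt_p.
have [prod_eq quartic_eq] := system_products sys.
have p0 : p != 0.
  by apply: contraTneq r_lt_p => ->; rewrite expr0n -leNgt sqr_ge0.
have quartic_gt0 : 0 < p ^+ 4 - s ^+ 4.
  by rewrite subr_gt0 !(exprM _ 2 2) ltr_pXn2r ?nnegrE ?sqr_ge0.
have [|N sqfN [t def_n]] := @squarefree_part `|p ^+ 4 - s ^+ 4|%N.
  by rewrite absz_gt0 lt0r_neq0.
have N_gt0 := squarefree_gt0 sqfN.
have quartic_s : (p%:~R ^+ 4 - s%:~R ^+ 4 : rat) = N%:R * t%:R ^+ 2.
  rewrite -!rmorphXn -rmorphB /= -(gtz0_abs quartic_gt0) def_n.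
  by rewrite -pmulrn natrM natrX.
have N0 : N%:R != 0 :> rat by rewrite pnatr_eq0 -lt0n.
have a0 : a%:~R != 0 :> rat by rewrite intr_eq0 lt0r_neq0.
have pQ0 : p%:~R != 0 :> rat by rewrite intr_eq0.
have rQ0 : r%:~R != 0 :> rat by rewrite intr_eq0.
have sQ0 : s%:~R != 0 :> rat by rewrite intr_eq0.
have sqrQ (n : int) : (n ^+ 2)%:~R = n%:~R ^+ 2 :> rat by rewrite rmorphXn.
have pr_gt0 : 0 < p%:~R ^+ 2 - r%:~R ^+ 2 :> rat.
  by rewrite subr_gt0 -!sqrQ ltr_int.
have ps_gt0 : 0 < p%:~R ^+ 2 - s%:~R ^+ 2 :> rat.
  by rewrite subr_gt0 -!sqrQ ltr_int.
have pr0 := lt0r_neq0 pr_gt0; have ps0 := lt0r_neq0 ps_gt0.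
have t0 : t%:R != 0 :> rat.
  apply: contraTneq quartic_gt0 => t0.
  by rewrite -(ltr_int rat) rmorphB !rmorphXn /= quartic_s t0 expr0n mulr0 ltxx.
have quartic_rs : (p%:~R ^+ 4 - s%:~R ^+ 4) * (p%:~R ^+ 4 - r%:~R ^+ 4)
    = (p%:~R ^+ 2 * a%:~R) ^+ 2 :> rat.
  by rewrite -!rmorphXn -!rmorphB -!rmorphM quartic_eq /= rmorphXn.
(* p^4 - r^4 = (p^2 a)^2 / (p^4 - s^4), so it has the squarefree part N too. *)
have quartic_r : p%:~R ^+ 4 - r%:~R ^+ 4
    = N%:R * (p%:~R ^+ 2 * a%:~R / (N%:R * t%:R)) ^+ 2 :> rat.
  have nz : p%:~R ^+ 4 - s%:~R ^+ 4 != 0 :> rat.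
    by rewrite quartic_s mulf_neq0 ?expf_neq0.
  apply: (mulfI nz); rewrite quartic_rs quartic_s; field.
  by rewrite N0 t0.
have qQ : q%:~R ^+ 2 = r%:~R ^+ 2 * s%:~R ^+ 2 / p%:~R ^+ 2 :> rat.
  apply: (mulfI (expf_neq0 2 pQ0)); rewrite [RHS]mulrC divfK ?expf_neq0 //.
  by rewrite -!sqrQ -!rmorphM prod_eq.
(* The unscaled factor has denominator 4 N^2 p^2, which this m squares to. *)
exists (2 * N%:Z * `|p|).
  by rewrite !mulr_gt0 ?normr_gt0 // ltz_nat.
set m := (X in X ^+ 2).
have m2 : m%:~R ^+ 2 = 4 * N%:R ^+ 2 * p%:~R ^+ 2 :> rat.
  rewrite -sqrQ /m exprMn real_normK ?num_real //.
  by rewrite !(rmorphXn, rmorphM) /= -pmulrn; ring.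
pose x := N%:R * ((p%:~R ^+ 2 + s%:~R ^+ 2) / (p%:~R ^+ 2 - s%:~R ^+ 2)) : rat.
pose z := N%:R * ((p%:~R ^+ 2 + r%:~R ^+ 2) / (p%:~R ^+ 2 - r%:~R ^+ 2)) : rat.
exists N, ((p ^+ 2 - s ^+ 2) * (p ^+ 2 - r ^+ 2)), x, z.
have kQ : ((p ^+ 2 - s ^+ 2) * (p ^+ 2 - r ^+ 2))%:~R
    = (p%:~R ^+ 2 - s%:~R ^+ 2) * (p%:~R ^+ 2 - r%:~R ^+ 2) :> rat.
  by rewrite rmorphM !rmorphB /= !sqrQ.
split=> //.
- by rewrite -(intr_eq0 rat) kQ mulf_neq0.
- rewrite -subr_eq0.
  have -> : x - z = 2 * N%:R * p%:~R ^+ 2 * (s%:~R ^+ 2 - r%:~R ^+ 2)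
     / ((p%:~R ^+ 2 - s%:~R ^+ 2) * (p%:~R ^+ 2 - r%:~R ^+ 2)).
    by rewrite /x /z; field; rewrite pr0 ps0.
  rewrite !mulf_neq0 ?invr_eq0 ?expf_neq0 ?mulf_neq0 //.
  by rewrite subr_eq0 -!sqrQ eqr_int eq_sym.
- split; first apply: (congruent_point_of_quartic (w := t%:R)) => //.
    by rewrite -subr_eq0 -oppr_eq0 opprB.
  apply: congruent_point_of_quartic quartic_r => //.
    by rewrite !mulf_neq0 ?invr_eq0 ?mulf_neq0.
  by rewrite -subr_eq0 -oppr_eq0 opprB.
split.
- by rewrite rmorphM exprMn m2 kQ /x /z /=; field; rewrite pr0 ps0.
- by rewrite rmorphM exprMn m2 qQ kQ /x /z /=; field; rewrite pr0 ps0 pQ0.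
- (* c is the rational square root of x z. *)
  pose c := a%:~R * N%:R * p%:~R ^+ 2
     / ((p%:~R ^+ 2 - s%:~R ^+ 2) * (p%:~R ^+ 2 - r%:~R ^+ 2)) : rat.
  have c_ge0 : 0 <= c.
    apply: divr_ge0; last by rewrite mulr_ge0 ?ltW.
    by rewrite mulr_ge0 ?sqr_ge0 // mulr_ge0 ?ler0n // ler0z ltW.
  have -> : x * z = c ^+ 2.
    transitivity (N%:R ^+ 2
        * ((p%:~R ^+ 4 - s%:~R ^+ 4) * (p%:~R ^+ 4 - r%:~R ^+ 4))
        / ((p%:~R ^+ 2 - s%:~R ^+ 2) * (p%:~R ^+ 2 - r%:~R ^+ 2)) ^+ 2 : rat).
      by rewrite /x /z; field; rewrite pr0 ps0.
    by rewrite quartic_rs /c; field; rewrite pr0 ps0.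
  rewrite rmorphXn /= sqrtr_sqr ger0_norm ?ler0q //.
  have eq_a : (m ^+ 2 * a)%:~R
      = ((p ^+ 2 - s ^+ 2) * (p ^+ 2 - r ^+ 2))%:~R * (4 * N%:R * c) :> rat.
    by rewrite rmorphM /= sqrQ m2 kQ /c; field; rewrite pr0 ps0.
  have /= := congr1 (ratr : rat -> R) eq_a.
  rewrite ratr_int => ->.
  by rewrite rmorphM [X in _ * X]rmorphM [X in _ * (X * _)]rmorphM /=
             ratr_int !rmorph_nat.
- by rewrite rmorphM exprMn m2 kQ /x /z /=; field; rewrite pr0 ps0.
- by rewrite rmorphM exprMn m2 kQ /x /z /=; field; rewrite pr0 ps0.
Qed.

Lemma pythagorean_system_swap (a p q r s : int) :
  pythagorean_system a p q r s -> pythagorean_system a q p r s.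
Proof. by case=> sum_eq diff_eq; split; rewrite -?sum_eq -?diff_eq; ring. Qed.

Lemma pythagorean_system_norm (a p q r s : int) :
  pythagorean_system a p q r s -> pythagorean_system `|a| p q r s.
Proof. by rewrite /pythagorean_system real_normK ?num_real. Qed.

(** The product (p^4 - s^4) (p^4 - r^4) is a nonzero square, so p^2 is either
    above both of r^2, s^2 or below both; in the latter case q^2 is above both
    because p^2 q^2 = r^2 s^2. *)
Lemma leg_dichotomy (a p q r s : int) :
    pythagorean_system a p q r s -> a != 0 -> p != 0 ->
    r != 0 -> s != 0 ->
  (r ^+ 2 < p ^+ 2) && (s ^+ 2 < p ^+ 2)
  || (r ^+ 2 < q ^+ 2) && (s ^+ 2 < q ^+ 2).
Proof.
move=> sys a0 p0 r0 s0; have [prod_eq quartic_eq] := system_products sys.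
have sqr0 (n : int) : n != 0 -> 0 < n ^+ 2 by move=> ?; rewrite exprn_even_gt0.
have : 0 < (p ^+ 4 - s ^+ 4) * (p ^+ 4 - r ^+ 4).
  by rewrite quartic_eq sqr0 // mulf_neq0 ?expf_neq0.
have sq4 (n : int) : n ^+ 4 = (n ^+ 2) ^+ 2 by rewrite -exprM.
rewrite !sq4.
move: (sqr0 p p0) (sqr0 r r0) (sqr0 s s0) prod_eq.
move: (p ^+ 2) (q ^+ 2) (r ^+ 2) (s ^+ 2) => P Q A B P0 A0 B0 PQ.
have sum_gt0 : 0 < (P + B) * (P + A) by rewrite mulr_gt0 ?addr_gt0.
rewrite !subr_sqr mulrACA (pmulr_lgt0 _ sum_gt0).
case: (ltgtP A P) => [AP | PA | ->]; last by rewrite subrr mulr0 ltxx.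
  by rewrite pmulr_lgt0 ?subr_gt0 // => ->.
rewrite nmulr_lgt0 ?subr_lt0 // => PB.
have AQ : A < Q by rewrite -(ltr_pM2l P0) PQ [P * A]mulrC ltr_pM2l.
have BQ : B < Q by rewrite -(ltr_pM2l P0) PQ ltr_pM2r.
by rewrite AQ BQ orbT.
Qed.

Theorem theorem4 (R : rcfType) (a p q r s : int) :
  (given_by_formulas R a p q r s -> nontrivial_solution a p q r s) /\
  (nontrivial_solution a p q r s -> r != - s ->
   exists2 m : int, 0 < m &
     given_by_formulas R (m ^+ 2 * `|a|) (m * p) (m * q) (m * r) (m * s) \/
     given_by_formulas R (m ^+ 2 * `|a|) (m * q) (m * p) (m * r) (m * s)).
Proof.
split; first exact: formulas_nontrivial.
move=> [sys]; rewrite !mulf_eq0 !negb_or.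
move=> /andP[/andP[/andP[/andP[a0 p0] q0] r0] s0] _ rs rNs.
have r2s2 : r ^+ 2 != s ^+ 2 by rewrite eqf_sqr negb_or rs.
have a_gt0 : 0 < `|a| by rewrite normr_gt0.
have sysN := pythagorean_system_norm sys.
have [/andP[rp sp] | /andP[rq sq]] := orP (leg_dichotomy sys a0 p0 r0 s0).
  have [m m0 ?] := formulas_of_dominant R sysN a_gt0 r0 s0 r2s2 rp sp.
  by exists m => //; left.
have [m m0 ?] := formulas_of_dominant R (pythagorean_system_swap sysN)
  a_gt0 r0 s0 r2s2 rq sq.
by exists m => //; right.
Qed.
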